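(* Let $\varphi$ be a continuous real valued function on the unit circle $\{z\in\mathbb{C}: |z|=1\}$. Then there exists a unique real valued function $u$ that is continuous on the closed unit disc $\{z\in\mathbb{C}:|z|\le 1\}$, is harmonic-ave on the open unit disc $D_1(0)$, and satisfies $u(z)=\varphi(z)$ for all $|z|=1$.
   Context: For $a\in\mathbb{C}$ and $r>0$, $D_r(a)$ denotes the open disc of radius $r$ about $a$. A continuous complex valued function $u$ on an open set $\Omega\subset\mathbb{C}$ is called harmonic-ave on $\Omega$ if it satisfies the averaging property $$u(a)=\frac{1}{2\pi}\int_0^{2\pi}u(a+re^{i\theta})\,d\theta$$ whenever the closure of $D_r(a)$ is contained in $\Omega$. *)

(* Defs.v *)
From Stdlib Require Export Reals.
From Coquelicot Require Export Coquelicot.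

Open Scope R_scope.

(* Coquelicot has no topological closure operator. *)
Definition closure {T : UniformSpace} (A : T -> Prop) (x : T) : Prop :=
  forall P : T -> Prop, locally x P -> exists y : T, P y /\ A y.

Definition disc (a : C) (r : R) (z : C) : Prop := Cmod (z - a)%C < r.

Definition closed_unit_disc (z : C) : Prop := Cmod z <= 1.

Definition unit_circle (z : C) : Prop := Cmod z = 1.

(* e^{i theta}; Coquelicot has no complex exponential. *)
Definition cis (theta : R) : C := (cos theta, sin theta).

(* [RInt] is total, but the integrand is continuous here: the circle lies in
   the closure of the disc, hence in [Omega]. *)
Definition harmonic_ave (Omega : C -> Prop) (u : C -> C) : Prop :=
  open Omega /\
  continuous_on Omega u /\
  forall (a : C) (r : R), 0 < r ->
    (forall z : C, closure (disc a r) z -> Omega z) ->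
    u a = (RtoC (1 / (2 * PI)) *
           RInt (V := C_R_CompleteNormedModule)
             (fun theta : R => u (a + r * cis theta)%C) 0 (2 * PI))%C.

(* Functions on a subset of [C] are total functions of which only the values on
   that subset matter: [continuous_on] is continuity for the subspace
   topology. *)
Definition dirichlet_solution (phi u : C -> R) : Prop :=
  continuous_on closed_unit_disc u /\
  harmonic_ave (disc 0 1) (fun z : C => RtoC (u z)) /\
  forall z : C, unit_circle z -> u z = phi z.

(* Main.v *)
Require Import Defs.
From Stdlib Require Import Reals Lra List Classical ClassicalEpsilon.
From Coquelicot Require Import Coquelicot.

(* Existence: the Poisson integral of [phi]. With [zeta = e^{it}], the kernel is
   [P(z,t) = (1 - |z|^2) / |zeta - z|^2 = 2 Re (zeta / (zeta - z)) - 1]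
   [= 2 Re (1 / (1 - conj z e^{it})) - 1],
   so its circle means in [z] and its total mass in [t] both reduce to the fact that
   [Re (c / (1 - q e^{it}))] has mean [Re c] when [|q| < 1]. Fubini then transfers the mean
   value property to the Poisson integral.

   Uniqueness: if [w] has the mean value property then [w + eps |z|^2] has no interior
   maximum, hence [w <= 0] on the disc as soon as [w <= 0] on the circle. *)

(** * Continuity and parametric integrals *)

(** Neither the Laplacian nor Cauchy's formula enters: averages are computed on explicit integrals
    of the form Re (c / (1 - q e^{is})). The two forms of the kernel serve two different variables
    of integration. On a circle z = a + r e^{i theta} the first one has this shape in theta, with q
    = r / (e^{it} - a); for the total mass the second one has it in t, with q = conj z. The
    perturbation eps |z|^2 raises the average over a circle of radius r by exactly eps r^2 above the
    central value. A single circle about an interior maximum is then contradictory, so no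
    propagation of the maximum through the disc has to be argued. *)

Lemma locally_Cmod (z : C) (P : C -> Prop) :
  locally z P <->
  exists delta : R, 0 < delta /\ forall y : C, Cmod (y - z)%C < delta -> P y.
Proof.
  split.
  - intros [eps He]. exists eps. split; [apply cond_pos|].
    intros y Hy. apply He. apply C_NormedModule_mixin_compat1. exact Hy.
  - intros (delta & Hd & H).
    (* Balls of the product structure on [C] are squares; the one of half-side delta / sqrt 2 lies
       in the disc of radius delta. *)
    assert (Hs : 0 < sqrt 2) by (apply sqrt_lt_R0; lra).
    assert (Hp : 0 < delta / sqrt 2) by (apply Rdiv_lt_0_compat; assumption).
    exists (mkposreal _ Hp). intros y Hy. apply H.
    pose proof (C_NormedModule_mixin_compat2 z y (mkposreal _ Hp) Hy) as H2.
    simpl in H2. replace (sqrt 2 * (delta / sqrt 2)) with delta in H2 by (field; lra).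
    exact H2.
Qed.

Lemma continuous_on_R_iff (D : C -> Prop) (f : C -> R) :
  continuous_on D f <->
  forall z : C, D z -> forall eps : R, 0 < eps ->
    exists delta : R, 0 < delta /\
      forall y : C, D y -> Cmod (y - z)%C < delta -> Rabs (f y - f z) < eps.
Proof.
  split.
  - intros H z Dz eps Heps.
    assert (L : locally z (fun y => D y -> Rabs (f y - f z) < eps)).
    { apply (H z Dz (fun x => Rabs (x - f z) < eps)).
      exists (mkposreal _ Heps). intros y Hy. exact Hy. }
    apply (locally_Cmod z) in L. destruct L as (delta & Hd & L).
    exists delta. split; [exact Hd|]. intros y Dy Hy. exact (L y Hy Dy).
  - intros H z Dz P [eps HP].
    destruct (H z Dz eps (cond_pos eps)) as (delta & Hd & L).
    apply (locally_Cmod z). exists delta. split; [exact Hd|].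
    intros y Hy Dy. apply HP. exact (L y Dy Hy).
Qed.

Lemma continuous_on_RtoC (D : C -> Prop) (f : C -> R) :
  continuous_on D f -> continuous_on D (fun z => RtoC (f z)).
Proof.
  intros H z Dz P HP. apply (locally_Cmod (RtoC (f z))) in HP.
  destruct HP as (delta & Hd & HP).
  apply (H z Dz (fun x => P (RtoC x))).
  exists (mkposreal _ Hd). intros y Hy. apply HP.
  rewrite <- RtoC_minus, Cmod_R. exact Hy.
Qed.

Lemma is_RInt_RtoC (f : R -> R) (a b l : R) :
  is_RInt f a b l ->
  is_RInt (V := C_R_CompleteNormedModule) (fun t => RtoC (f t)) a b (RtoC l).
Proof.
  intros H.
  apply (is_RInt_fct_extend_pair (U := R_NormedModule) (V := R_NormedModule)
           (fun t => RtoC (f t)) a b l 0).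
  - exact H.
  - pose proof (is_RInt_const (V := R_NormedModule) a b 0) as K.
    replace (scal (b - a) (0 : R_NormedModule)) with (0 : R_NormedModule) in K
      by (symmetry; apply Rmult_0_r).
    exact K.
Qed.

Lemma ex_RInt_of_continuous (f : R -> R) (a b : R) :
  (forall x, continuous f x) -> ex_RInt f a b.
Proof. intros H. apply (ex_RInt_continuous f). intros x _. apply H. Qed.

Lemma continuity_2d_pt_section_r (f : R -> R -> R) (x y : R) :
  continuity_2d_pt f x y -> continuous (f x) y.
Proof.
  intros H. apply continuity_2d_pt_filterlim in H.
  apply (continuous_comp_2 (fun _ => x) (fun t => t) f);
    [apply continuous_const|apply continuous_id|exact H].
Qed.

Lemma continuity_2d_pt_swap (f : R -> R -> R) (x y : R) :
  continuity_2d_pt f x y -> continuity_2d_pt (fun u v => f v u) y x.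
Proof.
  intros H eps. destruct (H eps) as [d Hd]. exists d. intros u v Hu Hv.
  apply Hd; assumption.
Qed.

Lemma continuous_RInt_param (f : R -> R -> R) (a b : R) :
  a <= b -> (forall x y, continuity_2d_pt f x y) ->
  forall y, continuous (fun y => RInt (fun s => f s y) a b) y.
Proof.
  intros Hab H y0 P [eps HP].
  assert (Hex : forall y, ex_RInt (fun s => f s y) a b).
  { intros y. apply ex_RInt_of_continuous. intros x.
    apply (continuity_2d_pt_section_r (fun u v => f v u)).
    apply continuity_2d_pt_swap, H. }
  (* The [+ 1] keeps the denominator positive when [a = b]. *)
  assert (Hp : 0 < eps / 2 / (b - a + 1)).
  { apply Rdiv_lt_0_compat; [|lra]. destruct eps; simpl; lra. }
  destruct (uniform_continuity_2d_1d f a b y0 (fun x _ => H x y0) (mkposreal _ Hp))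
    as [delta Hd].
  exists delta. intros y Hy. apply HP.
  change (Rabs (y - y0) < delta) in Hy.
  apply Rabs_def2 in Hy. destruct delta as [delta Hdelta]; simpl in *.
  change (Rabs (RInt (fun s => f s y) a b - RInt (fun s => f s y0) a b) < eps).
  rewrite <- (RInt_minus (V := R_CompleteNormedModule)) by apply Hex.
  apply Rle_lt_trans with ((b - a) * (eps / 2 / (b - a + 1))).
  - apply abs_RInt_le_const; [lra| |].
    + apply (ex_RInt_minus (V := R_NormedModule)); apply Hex.
    + intros t Ht. left. apply Hd; try lra. rewrite Rminus_diag, Rabs_R0. lra.
  - destruct eps as [eps He]; simpl in *.
    apply Rlt_le_trans with ((b - a + 1) * (eps / 2 / (b - a + 1)) + eps/2).
    + nra.
    + right. field. lra.
Qed.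

(** As functions of the upper limit [b], both sides vanish at [a] and have the same derivative:
    differentiation under the integral sign turns the left one into the integral of [f b t] over
    [t]. *)
Lemma RInt_swap (f : R -> R -> R) (a b c d : R) :
  a <= b -> c <= d -> (forall x y, continuity_2d_pt f x y) ->
  RInt (fun t => RInt (fun s => f s t) a b) c d =
  RInt (fun s => RInt (fun t => f s t) c d) a b.
Proof.
  intros Hab Hcd H.
  assert (Hx : forall t x, continuous (fun s => f s t) x).
  { intros t x. apply (continuity_2d_pt_section_r (fun u v => f v u)).
    apply continuity_2d_pt_swap, H. }
  assert (HD : forall t x, is_derive (fun x => RInt (fun s => f s t) a x) x (f x t)).
  { intros t x. apply (is_derive_RInt (fun s => f s t) _ a).
    - apply filter_forall. intros y. apply (RInt_correct (V := R_CompleteNormedModule)).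
      apply ex_RInt_of_continuous, Hx.
    - apply Hx. }
  assert (HG : forall x, a <= x -> True ->
    is_derive (fun x => RInt (fun t => RInt (fun s => f s t) a x) c d) x
              (RInt (fun t => f x t) c d)).
  { intros x _ _.
    rewrite (RInt_ext (fun t => f x t) (fun t => Derive (fun x => RInt (fun s => f s t) a x) x))
      by (intros t _; symmetry; apply is_derive_unique, HD).
    apply (is_derive_RInt_param (fun x t => RInt (fun s => f s t) a x)).
    - apply filter_forall. intros y t _. eexists. apply HD.
    - intros t _. apply (continuity_2d_pt_ext f).
      + intros u v. symmetry. apply is_derive_unique, HD.
      + apply H.
    - apply filter_forall. intros y. apply ex_RInt_of_continuous. intros t.
      (* Integrability is required for all [y] near [x], and for [x = a] these include [y < a];
         there the bounds are exchanged, since [continuous_RInt_param] wants them in order. *)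
      destruct (Rle_dec a y) as [Hay|Hay].
      + apply continuous_RInt_param; [exact Hay|exact H].
      + apply (continuous_ext (fun t => - RInt (fun s => f s t) y a)).
        * intros s. apply (opp_RInt_swap (V := R_CompleteNormedModule)).
          apply ex_RInt_of_continuous, Hx.
        * apply (continuous_opp (V := R_NormedModule)).
          apply continuous_RInt_param; [lra|exact H]. }
  assert (HI : is_RInt (fun s => RInt (fun t => f s t) c d) a b
     (minus (RInt (fun t => RInt (fun s => f s t) a b) c d)
            (RInt (fun t => RInt (fun s => f s t) a a) c d))).
  { apply (is_RInt_derive (fun x => RInt (fun t => RInt (fun s => f s t) a x) c d)).
    - intros x Hx'. rewrite Rmin_left in Hx' by lra. apply HG; [lra|exact I].
    - intros x _. apply (continuous_RInt_param (fun u v => f v u)); [exact Hcd|].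
      intros u v. apply continuity_2d_pt_swap, H. }
  assert (E : RInt (fun t => RInt (fun s => f s t) a a) c d = 0).
  { rewrite (RInt_ext (fun t => RInt (fun s => f s t) a a) (fun _ => 0))
      by (intros; apply (RInt_point (V := R_CompleteNormedModule))).
    rewrite (RInt_const (V := R_CompleteNormedModule)). apply Rmult_0_r. }
  rewrite E in HI. rewrite (is_RInt_unique _ _ _ _ HI).
  symmetry. apply Rminus_0_r.
Qed.

(** * The mean of a geometric series *)

Lemma Cmod_cis (t : R) : Cmod (cis t) = 1.
Proof.
  unfold Cmod, cis; simpl.
  replace (cos t * (cos t * 1) + sin t * (sin t * 1)) with 1.
  - apply sqrt_1.
  - pose proof (sin2_cos2 t) as H. unfold Rsqr in H. lra.
Qed.

Lemma Cmod_sqr (z : C) : Cmod z * Cmod z = fst z * fst z + snd z * snd z.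
Proof. unfold Cmod. rewrite sqrt_sqrt; [ring|]. nra. Qed.

Lemma cis_add (s t : R) : cis (s + t) = (cis s * cis t)%C.
Proof. unfold cis, Cmult; simpl. rewrite cos_plus, sin_plus. f_equal; ring. Qed.

Lemma Cmod_1_sub_ge (q : C) (t : R) : 1 - Cmod q <= Cmod (1 - q * cis t)%C.
Proof.
  pose proof (Cmod_triangle (1 - q * cis t)%C (q * cis t)%C) as H.
  replace (1 - q * cis t + q * cis t)%C with (RtoC 1) in H by ring.
  rewrite Cmod_1, Cmod_mult, Cmod_cis in H. lra.
Qed.

Lemma continuous_geometric_kernel (c q : C) (k t : R) :
  Cmod q < 1 ->
  continuous (fun t => Re (c * cis (k * t) / (1 - q * cis t))%C) t.
Proof.
  intros Hq. destruct c as [c1 c2]. destruct q as [q1 q2].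
  pose proof (Cmod_1_sub_ge (q1, q2) t) as H.
  pose proof (Cmod_sqr (1 - (q1, q2) * cis t)%C) as H2.
  apply (ex_derive_continuous (V := R_NormedModule)).
  unfold Re, cis, Cdiv, Cinv, Cmult, Cminus, Cplus, Copp, RtoC in *; simpl in *.
  auto_derive. repeat split; nra.
Qed.

Lemma RInt_cis_harmonic (c : C) (n : nat) :
  (0 < n)%nat -> is_RInt (fun t => Re (c * cis (INR n * t))%C) 0 (2 * PI) 0.
Proof.
  intros Hn. apply lt_0_INR in Hn. destruct c as [c1 c2].
  (* [F] is Im (c e^{int}) / n, an antiderivative with equal values at 0 and 2 PI. *)
  set (F := fun t => (c1 * sin (INR n * t) + c2 * cos (INR n * t)) / INR n).
  replace 0 with (minus (F (2 * PI)) (F 0)) at 2.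
  - apply (is_RInt_derive F).
    + intros t _. unfold F, Re, cis, Cmult; simpl. auto_derive; [lra|]. field. lra.
    + intros t _. apply (ex_derive_continuous (V := R_NormedModule)).
      unfold Re, cis, Cmult; simpl. auto_derive. exact I.
  - unfold F. rewrite Rmult_0_r, sin_0, cos_0.
    replace (INR n * (2 * PI)) with (0 + 2 * INR n * PI) by ring.
    rewrite sin_period, cos_period, sin_0, cos_0.
    apply Rminus_diag.
Qed.

(** One step of the geometric series, 1 / (1 - w) = 1 + w / (1 - w) with w = q e^{it}, multiplied by
    c e^{int} and integrated. *)
Lemma RInt_geometric_kernel_shift (c q : C) (n : nat) :
  Cmod q < 1 ->
  RInt (fun t => Re (c * cis (INR n * t) / (1 - q * cis t))%C) 0 (2 * PI) =
  RInt (fun t => Re (c * cis (INR n * t))%C) 0 (2 * PI) +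
  RInt (fun t => Re (c * q * cis (INR (S n) * t) / (1 - q * cis t))%C) 0 (2 * PI).
Proof.
  intros Hq.
  rewrite <- (RInt_plus (V := R_CompleteNormedModule)).
  - apply (RInt_ext (V := R_CompleteNormedModule)). intros t _.
    change (Re (c * cis (INR n * t) / (1 - q * cis t))%C =
      Re (c * cis (INR n * t))%C + Re (c * q * cis (INR (S n) * t) / (1 - q * cis t))%C).
    rewrite <- re_plus. f_equal.
    rewrite S_INR. replace ((INR n + 1) * t) with (INR n * t + t) by ring.
    rewrite cis_add. field.
    intros E. pose proof (Cmod_1_sub_ge q t) as H. rewrite E, Cmod_0 in H. lra.
  - apply ex_RInt_of_continuous. intros t.
    apply (ex_derive_continuous (V := R_NormedModule)).
    unfold Re, cis, Cmult; simpl. auto_derive. exact I.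
  - apply ex_RInt_of_continuous. intros t. apply continuous_geometric_kernel, Hq.
Qed.

(* The integral is unchanged when [(c, n)] becomes [(c q, n + 1)]; iterating makes it
   smaller than any positive number. *)
Lemma RInt_geometric_kernel_harmonic (c q : C) (n : nat) :
  Cmod q < 1 -> (0 < n)%nat ->
  RInt (fun t => Re (c * cis (INR n * t) / (1 - q * cis t))%C) 0 (2 * PI) = 0.
Proof.
  intros Hq Hn. set (J := RInt _ _ _).
  assert (HJ : forall k, J =
    RInt (fun t => Re (c * q ^ k * cis (INR (k + n) * t) / (1 - q * cis t))%C) 0 (2 * PI)).
  { induction k as [|k IH].
    - change (c * q ^ 0)%C with (c * 1)%C. rewrite Cmult_1_r. reflexivity.
    - rewrite IH, RInt_geometric_kernel_shift by exact Hq.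
      rewrite (is_RInt_unique _ _ _ _ (RInt_cis_harmonic (c * q ^ k)%C (k + n)
                 (Nat.lt_le_trans _ _ _ Hn (Nat.le_add_l n k)))).
      rewrite Rplus_0_l. change (q ^ S k)%C with (q * q ^ k)%C.
      rewrite (Cmult_comm q), Cmult_assoc. reflexivity. }
  assert (HB : forall k, Rabs J <= 2 * PI * (Cmod c / (1 - Cmod q)) * Cmod q ^ k).
  { intros k. rewrite (HJ k).
    replace (2 * PI * (Cmod c / (1 - Cmod q)) * Cmod q ^ k)
      with ((2 * PI - 0) * (Cmod c * Cmod q ^ k / (1 - Cmod q))) by (field; lra).
    apply abs_RInt_le_const.
    - pose proof PI_RGT_0. lra.
    - apply ex_RInt_of_continuous. intros t. apply continuous_geometric_kernel, Hq.
    - intros t _. eapply Rle_trans; [apply re_le_Cmod|].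
      pose proof (Cmod_1_sub_ge q t) as H.
      rewrite Cmod_div by (intros E; rewrite E, Cmod_0 in H; lra).
      rewrite !Cmod_mult, Cmod_cis, Rmult_1_r.
      assert (E : Cmod (q ^ k)%C = Cmod q ^ k).
      { induction k as [|k IH]; simpl; [apply Cmod_1|rewrite Cmod_mult, IH; reflexivity]. }
      rewrite E. apply Rmult_le_compat_l.
      + apply Rmult_le_pos; [apply Cmod_ge_0|apply pow_le, Cmod_ge_0].
      + apply Rinv_le_contravar; lra. }
  apply NNPP. intros HJ0. apply Rabs_pos_lt in HJ0.
  set (M := 2 * PI * (Cmod c / (1 - Cmod q))) in HB.
  (* At [k = 0] the bound reads |J| <= M, so the assumption [J <> 0] makes [M] positive. *)
  assert (HM : 0 < M) by (specialize (HB 0%nat); simpl in HB; lra).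
  destruct (pow_lt_1_zero (Cmod q)) with (y := Rabs J / M) as [N HN].
  - rewrite Rabs_pos_eq by apply Cmod_ge_0. exact Hq.
  - apply Rdiv_lt_0_compat; assumption.
  - specialize (HN N (le_n N)). rewrite Rabs_pos_eq in HN by apply pow_le, Cmod_ge_0.
    specialize (HB N). apply (Rmult_lt_compat_l M) in HN; [|exact HM].
    replace (M * (Rabs J / M)) with (Rabs J) in HN by (field; lra). lra.
Qed.

(** A single shift from [n = 0] splits off the constant term [c]; the remainder starts at [n = 1]
    and integrates to 0. *)
Lemma is_RInt_geometric_kernel (c q : C) :
  Cmod q < 1 ->
  is_RInt (fun t => Re (c / (1 - q * cis t))%C) 0 (2 * PI) (2 * PI * Re c).
Proof.
  intros Hq.
  assert (E : forall t, (c * cis (INR 0 * t))%C = c).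
  { intros t. simpl. rewrite Rmult_0_l. unfold cis. rewrite cos_0, sin_0. apply Cmult_1_r. }
  apply (is_RInt_ext (fun t => Re (c * cis (INR 0 * t) / (1 - q * cis t))%C)).
  - intros t _. rewrite E. reflexivity.
  - replace (2 * PI * Re c)
      with (RInt (fun t => Re (c * cis (INR 0 * t) / (1 - q * cis t))%C) 0 (2 * PI)).
    + apply (RInt_correct (V := R_CompleteNormedModule)).
      apply ex_RInt_of_continuous. intros t. apply continuous_geometric_kernel, Hq.
    + rewrite RInt_geometric_kernel_shift, RInt_geometric_kernel_harmonic by (auto with arith).
      rewrite (RInt_ext _ (fun _ => Re c)) by (intros t _; rewrite E; reflexivity).
      rewrite (RInt_const (V := R_CompleteNormedModule)).
      change ((2 * PI - 0) * Re c + 0 = 2 * PI * Re c). ring.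
Qed.

(** * The Poisson kernel *)

(** Real coordinates make continuity, separately and jointly, a matter of rational functions of cos
    and sin. The normalisation 1 / (2 PI) is left to [poisson_integral]. *)
Definition poisson_kernel (z : C) (t : R) : R :=
  (1 - (fst z * fst z + snd z * snd z)) /
  ((cos t - fst z) * (cos t - fst z) + (sin t - snd z) * (sin t - snd z)).

Lemma poisson_kernel_Cmod (z : C) (t : R) :
  poisson_kernel z t =
  (1 - Cmod z * Cmod z) / (Cmod (cis t - z)%C * Cmod (cis t - z)%C).
Proof. unfold poisson_kernel. rewrite !Cmod_sqr. reflexivity. Qed.

Lemma Cmod_cis_sub_ge (z : C) (t : R) : 1 - Cmod z <= Cmod (cis t - z)%C.
Proof.
  pose proof (Cmod_triangle (cis t - z)%C z) as H.
  replace (cis t - z + z)%C with (cis t) in H by ring.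
  rewrite Cmod_cis in H. lra.
Qed.

Lemma poisson_kernel_den_pos (z : C) (t : R) :
  Cmod z < 1 ->
  0 < (cos t - fst z) * (cos t - fst z) + (sin t - snd z) * (sin t - snd z).
Proof.
  intros Hz. pose proof (Cmod_cis_sub_ge z t) as H.
  pose proof (Cmod_sqr (cis t - z)%C) as E. simpl in E.
  unfold Rminus. rewrite <- E. nra.
Qed.

Lemma poisson_kernel_ge_0 (z : C) (t : R) : Cmod z < 1 -> 0 <= poisson_kernel z t.
Proof.
  intros Hz. apply Rdiv_le_0_compat.
  - rewrite <- Cmod_sqr. pose proof (Cmod_ge_0 z). nra.
  - apply poisson_kernel_den_pos, Hz.
Qed.

Lemma poisson_kernel_Re (z : C) (t : R) :
  Cmod z < 1 -> poisson_kernel z t = 2 * Re (cis t / (cis t - z))%C - 1.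
Proof.
  intros Hz. pose proof (poisson_kernel_den_pos z t Hz) as H.
  pose proof (sin2_cos2 t) as T. unfold Rsqr in T. destruct z as [x y].
  unfold poisson_kernel, Re, cis, Cdiv, Cinv, Cmult, Cminus, Cplus, Copp in *; simpl in *.
  set (u := cos t) in *. set (v := sin t) in *.
  (* The 1 stands for |e^{it}|^2; once this is explicit, the goal is a rational identity in [u],
     [v], [x], [y]. *)
  replace (1 - (x * x + y * y)) with (v * v + u * u - (x * x + y * y)) by lra.
  field. nra.
Qed.

(** On the unit circle zeta / (zeta - z) = 1 / (1 - z conj zeta), and conjugation leaves the real
    part unchanged. *)
Lemma poisson_kernel_Re_conj (z : C) (t : R) :
  Cmod z < 1 -> poisson_kernel z t = 2 * Re (1 / (1 - Cconj z * cis t))%C - 1.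
Proof.
  intros Hz. pose proof (poisson_kernel_den_pos z t Hz) as H.
  pose proof (sin2_cos2 t) as T. unfold Rsqr in T. destruct z as [x y].
  unfold poisson_kernel, Re, cis, Cconj, Cdiv, Cinv, Cmult, Cminus, Cplus, Copp, RtoC in *;
    simpl in *.
  set (u := cos t) in *. set (v := sin t) in *.
  set (N := (u - x) * (u - x) + (v - y) * (v - y)) in *.
  (* This is |1 - conj z e^{it}|^2 = |e^{it} - z|^2, which rests on |e^{it}| = 1. *)
  assert (E : (1 + - (x * u - - y * v)) * ((1 + - (x * u - - y * v)) * 1) +
              (0 + - (x * v + - y * u)) * ((0 + - (x * v + - y * u)) * 1) = N)
    by (unfold N; nra).
  rewrite E. apply (Rmult_eq_reg_r N); [|lra].
  replace ((1 - (x * x + y * y)) / N * N) with (1 - (x * x + y * y)) by (field; lra).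
  field_simplify; [unfold N; nra|lra].
Qed.

Lemma is_RInt_affine (f : R -> R) (a b l c d : R) :
  is_RInt f a b l -> is_RInt (fun t => c * f t + d) a b (c * l + (b - a) * d).
Proof.
  intros H. apply (is_RInt_plus (V := R_NormedModule) (fun t => c * f t) (fun _ => d)).
  - apply (is_RInt_scal (V := R_NormedModule)), H.
  - apply (is_RInt_const (V := R_NormedModule)).
Qed.

Lemma is_RInt_poisson_kernel (z : C) :
  Cmod z < 1 -> is_RInt (poisson_kernel z) 0 (2 * PI) (2 * PI).
Proof.
  intros Hz.
  apply (is_RInt_ext (fun t => 2 * Re (1 / (1 - Cconj z * cis t))%C + -1)).
  - intros t _. rewrite poisson_kernel_Re_conj by exact Hz. reflexivity.
  - replace (2 * PI) with (2 * (2 * PI * Re 1) + (2 * PI - 0) * -1) at 2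
      by (simpl; ring).
    apply is_RInt_affine, is_RInt_geometric_kernel. rewrite Cmod_conj. exact Hz.
Qed.

Lemma Cmod_circle_lt (a : C) (r theta : R) :
  0 < r -> Cmod a + r < 1 -> Cmod (a + r * cis theta)%C < 1.
Proof.
  intros Hr Ha. eapply Rle_lt_trans; [apply Cmod_triangle|].
  rewrite Cmod_mult, Cmod_cis, Cmod_R, Rabs_pos_eq; lra.
Qed.

(** With b = e^{it} - a the denominator e^{it} - z factors as b (1 - (r / b) e^{i theta}), and |b|
    >= 1 - |a| > r gives |r / b| < 1. *)
Lemma is_RInt_poisson_kernel_circle (a : C) (r t : R) :
  0 < r -> Cmod a + r < 1 ->
  is_RInt (fun theta => poisson_kernel (a + r * cis theta)%C t) 0 (2 * PI)
          (2 * PI * poisson_kernel a t).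
Proof.
  intros Hr Ha.
  pose proof (Cmod_cis_sub_ge a t) as Hb. set (b := (cis t - a)%C) in *.
  assert (Hb0 : b <> 0) by (intros E; rewrite E, Cmod_0 in Hb; lra).
  assert (Hq : Cmod (r / b)%C < 1).
  { rewrite Cmod_div by exact Hb0. rewrite Cmod_R, Rabs_pos_eq by lra.
    apply Rlt_div_l; lra. }
  apply (is_RInt_ext (fun theta => 2 * Re (cis t / b / (1 - r / b * cis theta))%C + -1)).
  - intros theta _. rewrite poisson_kernel_Re by (apply Cmod_circle_lt; assumption).
    unfold Rminus. do 3 f_equal.
    assert (H1 : (1 - r / b * cis theta)%C <> 0).
    { intros E. pose proof (Cmod_1_sub_ge (r / b)%C theta) as H.
      rewrite E, Cmod_0 in H. lra. }
    replace (cis t - (a + r * cis theta))%C with (b * (1 - r / b * cis theta))%C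
      by (unfold b in *; field; exact Hb0).
    generalize dependent (1 - r / b * cis theta)%C. intros w Hw. field. split; assumption.
  - replace (2 * PI * poisson_kernel a t)
      with (2 * (2 * PI * Re (cis t / b)%C) + (2 * PI - 0) * -1).
    + apply is_RInt_affine, is_RInt_geometric_kernel, Hq.
    + rewrite poisson_kernel_Re by lra. fold b. ring.
Qed.

(** The boundary datum is a function of the angle; it is applied to [g t = phi (cis t)]. *)
Definition poisson_integral (g : R -> R) (z : C) : R :=
  RInt (fun t => poisson_kernel z t * g t) 0 (2 * PI) / (2 * PI).

Lemma continuous_poisson_kernel (z : C) (t : R) :
  Cmod z < 1 -> continuous (poisson_kernel z) t.
Proof.
  intros Hz. pose proof (poisson_kernel_den_pos z t Hz) as H.
  apply (ex_derive_continuous (V := R_NormedModule)).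
  unfold poisson_kernel. auto_derive. unfold Rminus in H. lra.
Qed.

Lemma ex_RInt_poisson (g : R -> R) (z : C) :
  (forall t, continuous g t) -> Cmod z < 1 ->
  ex_RInt (fun t => poisson_kernel z t * g t) 0 (2 * PI).
Proof.
  intros Hg Hz. apply ex_RInt_of_continuous. intros t.
  apply (continuous_mult (K := R_AbsRing)); [apply continuous_poisson_kernel, Hz|apply Hg].
Qed.

Lemma continuity_2d_pt_poisson (g : R -> R) (a : C) (r x y : R) :
  (forall t, continuous g t) -> 0 < r -> Cmod a + r < 1 ->
  continuity_2d_pt (fun t theta => poisson_kernel (a + r * cis theta)%C t * g t) x y.
Proof.
  intros Hg Hr Ha.
  pose proof (poisson_kernel_den_pos (a + r * cis y)%C x (Cmod_circle_lt a r y Hr Ha)) as H.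
  assert (C1 : forall h : R -> R, (forall s, continuous h s) ->
     continuity_2d_pt (fun t _ => h t) x y).
  { intros h Hh. apply continuity_1d_2d_pt_comp.
    - apply continuity_pt_filterlim, Hh.
    - apply continuity_2d_pt_id1. }
  assert (C2 : forall h : R -> R, (forall s, continuous h s) ->
     continuity_2d_pt (fun _ th => h th) x y).
  { intros h Hh. apply continuity_1d_2d_pt_comp.
    - apply continuity_pt_filterlim, Hh.
    - apply continuity_2d_pt_id2. }
  apply continuity_2d_pt_mult; [|apply C1, Hg].
  assert (X : continuity_2d_pt (fun _ th => fst (a + r * cis th)%C) x y).
  { apply (C2 (fun th => fst (a + r * cis th)%C)). intros s.
    apply (ex_derive_continuous (V := R_NormedModule)). simpl. auto_derive. exact I. }
  assert (Y : continuity_2d_pt (fun _ th => snd (a + r * cis th)%C) x y).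
  { apply (C2 (fun th => snd (a + r * cis th)%C)). intros s.
    apply (ex_derive_continuous (V := R_NormedModule)). simpl. auto_derive. exact I. }
  unfold poisson_kernel, Rdiv.
  apply continuity_2d_pt_mult; [|apply continuity_2d_pt_inv; [|lra]];
    repeat first [ exact X | exact Y | apply continuity_2d_pt_const
          | apply (C1 cos); intros s; apply continuous_cos
          | apply (C1 sin); intros s; apply continuous_sin
          | apply continuity_2d_pt_minus | apply continuity_2d_pt_plus
          | apply continuity_2d_pt_mult ].
Qed.

Lemma is_RInt_poisson_integral_circle (g : R -> R) (a : C) (r : R) :
  (forall t, continuous g t) -> 0 < r -> Cmod a + r < 1 ->
  is_RInt (fun theta => poisson_integral g (a + r * cis theta)%C) 0 (2 * PI)
          (2 * PI * poisson_integral g a).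
Proof.
  intros Hg Hr Ha. pose proof PI_RGT_0 as HPI.
  pose proof (fun x y => continuity_2d_pt_poisson g a r x y Hg Hr Ha) as Hc.
  set (f := fun t theta => poisson_kernel (a + r * cis theta)%C t * g t) in *.
  replace (2 * PI * poisson_integral g a)
    with (RInt (fun theta => RInt (fun t => f t theta) 0 (2 * PI)) 0 (2 * PI) / (2 * PI)).
  - unfold poisson_integral, Rdiv.
    apply (is_RInt_ext (fun theta => scal (/ (2 * PI)) (RInt (fun t => f t theta) 0 (2 * PI)))).
    { intros theta _. apply Rmult_comm. }
    rewrite (Rmult_comm (RInt _ _ _)). apply (is_RInt_scal (V := R_NormedModule)).
    apply (RInt_correct (V := R_CompleteNormedModule)), ex_RInt_of_continuous.
    apply continuous_RInt_param; [lra|exact Hc].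
  (* After the exchange the inner integral runs over theta with [g t] as a constant factor, and is
     the circle mean of the kernel. *)
  - rewrite RInt_swap; [|lra|lra|exact Hc].
    rewrite (RInt_ext _ (fun t => 2 * PI * (poisson_kernel a t * g t))).
    + rewrite (RInt_scal (V := R_CompleteNormedModule) _ 0 (2 * PI) (2 * PI))
        by (apply ex_RInt_poisson; [exact Hg|lra]).
      unfold poisson_integral, scal; simpl; unfold mult; simpl. field. lra.
    + intros t _. unfold f. apply is_RInt_unique.
      replace (2 * PI * (poisson_kernel a t * g t))
        with (scal (g t) (2 * PI * poisson_kernel a t))
        by (unfold scal; simpl; unfold mult; simpl; ring).
      apply (is_RInt_ext (fun th => scal (g t) (poisson_kernel (a + r * cis th)%C t))).
      { intros th _. apply Rmult_comm. }
      apply (is_RInt_scal (V := R_NormedModule)), is_RInt_poisson_kernel_circle; assumption.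
Qed.

(** * Continuity of the Poisson integral *)

Lemma Cmod_sub_comm (y z : C) : Cmod (y - z)%C = Cmod (z - y)%C.
Proof. replace (y - z)%C with (- (z - y))%C by ring. apply Cmod_opp. Qed.

Lemma Cmod_le_sub_add (y z : C) : Cmod y <= Cmod (y - z)%C + Cmod z.
Proof.
  replace (Cmod y) with (Cmod (y - z + z)%C) by (f_equal; ring). apply Cmod_triangle.
Qed.

Lemma Rabs_Cmod_sub_le (y z : C) : Rabs (Cmod y - Cmod z) <= Cmod (y - z)%C.
Proof.
  pose proof (Cmod_le_sub_add y z). pose proof (Cmod_le_sub_add z y).
  rewrite (Cmod_sub_comm z y) in *. apply Rabs_le. lra.
Qed.

(** The difference is twice the real part of zeta (z - z0) / ((zeta - z)(zeta - z0)), whose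
    denominator factors have modulus at least d / 2 and d; hence 2 / (d^2 / 2) = 4 / d^2. *)
Lemma poisson_kernel_lipschitz (z z0 : C) (t d : R) :
  0 < d -> Cmod z0 <= 1 - d -> Cmod (z - z0)%C < d / 2 ->
  Rabs (poisson_kernel z t - poisson_kernel z0 t) <= 4 / (d * d) * Cmod (z - z0)%C.
Proof.
  intros Hd Hz0 Hz. pose proof (Cmod_le_sub_add z z0) as Hz1.
  rewrite !poisson_kernel_Re by lra.
  pose proof (Cmod_cis_sub_ge z t) as H1. pose proof (Cmod_cis_sub_ge z0 t) as H0.
  assert (N1 : (cis t - z)%C <> 0) by (intros E; rewrite E, Cmod_0 in H1; lra).
  assert (N0 : (cis t - z0)%C <> 0) by (intros E; rewrite E, Cmod_0 in H0; lra).
  set (D := (cis t * (z - z0) / ((cis t - z) * (cis t - z0)))%C).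
  replace (2 * Re (cis t / (cis t - z))%C - 1 - (2 * Re (cis t / (cis t - z0))%C - 1))
    with (2 * Re D).
  2: { replace (cis t / (cis t - z))%C with (cis t / (cis t - z0) + D)%C
         by (unfold D; field; split; assumption).
       rewrite re_plus. ring. }
  rewrite Rabs_mult, (Rabs_pos_eq 2) by lra.
  eapply Rle_trans; [apply Rmult_le_compat_l; [lra|apply re_le_Cmod]|].
  unfold D. rewrite Cmod_div by (apply Cmult_neq_0; assumption).
  rewrite !Cmod_mult, Cmod_cis, Rmult_1_l.
  replace (4 / (d * d) * Cmod (z - z0)%C) with (2 * (Cmod (z - z0)%C * / (d / 2 * d)))
    by (field; lra).
  apply Rmult_le_compat_l; [lra|]. apply Rmult_le_compat_l; [apply Cmod_ge_0|].
  apply Rinv_le_contravar; [nra|]. apply Rmult_le_compat; lra.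
Qed.

Lemma poisson_integral_continuous (g : R -> R) (z0 : C) :
  (forall t, continuous g t) -> Cmod z0 < 1 ->
  forall eps, 0 < eps -> exists delta, 0 < delta /\
    forall z, Cmod (z - z0)%C < delta ->
      Rabs (poisson_integral g z - poisson_integral g z0) < eps.
Proof.
  intros Hg Hz0 eps Heps. pose proof PI_RGT_0 as HPI.
  destruct (continuity_ab_maj (fun t => Rabs (g t)) 0 (2 * PI)) as (m & Hm & _).
  { lra. }
  { intros t _. apply continuity_pt_filterlim, (continuous_comp g Rabs); [apply Hg|].
    apply continuous_Rabs. }
  set (M := Rabs (g m)) in *. assert (HM : 0 <= M) by apply Rabs_pos.
  set (d := 1 - Cmod z0). assert (Hd : 0 < d) by (unfold d; lra).
  (* A local Lipschitz constant for the Poisson integral: that of the kernel times a bound for |g|.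
     Since [L] can be 0, the radius below divides by [L + 1]. *)
  set (L := 4 / (d * d) * M).
  assert (HL : 0 <= L).
  { apply Rmult_le_pos; [|exact HM]. apply Rdiv_le_0_compat; [lra|nra]. }
  exists (Rmin (d / 2) (eps / (L + 1))). split.
  { apply Rmin_pos; [lra|]. apply Rdiv_lt_0_compat; lra. }
  intros z Hz.
  assert (Hz1 : Cmod (z - z0)%C < d / 2) by (eapply Rlt_le_trans; [exact Hz|apply Rmin_l]).
  assert (Hz2 : Cmod (z - z0)%C < eps / (L + 1)) by (eapply Rlt_le_trans; [exact Hz|apply Rmin_r]).
  assert (Hzd : Cmod z < 1) by (pose proof (Cmod_le_sub_add z z0); unfold d in *; lra).
  assert (HI : Rabs (poisson_integral g z - poisson_integral g z0) <= L * Cmod (z - z0)%C).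
  { unfold poisson_integral, Rdiv. rewrite <- Rmult_minus_distr_r.
    rewrite <- (RInt_minus (V := R_CompleteNormedModule)) by (apply ex_RInt_poisson; assumption).
    rewrite Rabs_mult, (Rabs_pos_eq (/ _))
      by (left; apply Rinv_0_lt_compat; lra).
    apply Rle_div_l; [lra|].
    replace (L * Cmod (z - z0)%C * (2 * PI)) with ((2 * PI - 0) * (L * Cmod (z - z0)%C)) by ring.
    apply abs_RInt_le_const; [lra| |].
    - apply (ex_RInt_minus (V := R_NormedModule)); apply ex_RInt_poisson; assumption.
    - intros t Ht.
      change (Rabs (poisson_kernel z t * g t - poisson_kernel z0 t * g t) <= L * Cmod (z - z0)%C).
      rewrite <- Rmult_minus_distr_r, Rabs_mult.
      unfold L. rewrite (Rmult_comm _ M), Rmult_assoc, (Rmult_comm M).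
      apply Rmult_le_compat; try apply Rabs_pos; [|apply Hm, Ht].
      apply poisson_kernel_lipschitz; unfold d in *; lra. }
  apply Rlt_div_r in Hz2; [|lra]. pose proof (Cmod_ge_0 (z - z0)%C). nra.
Qed.

(** The kernel has mean 1, so the difference is the mean of P (g - c), and the pointwise bound
    averages to eps + B. *)
Lemma poisson_integral_sub_const_le (g : R -> R) (z : C) (c eps B : R) :
  (forall t, continuous g t) -> Cmod z < 1 ->
  (forall t, 0 <= t <= 2 * PI ->
     poisson_kernel z t * Rabs (g t - c) <= eps * poisson_kernel z t + B) ->
  Rabs (poisson_integral g z - c) <= eps + B.
Proof.
  intros Hg Hz H. pose proof PI_RGT_0 as HPI.
  pose proof (is_RInt_poisson_kernel z Hz) as HK.
  assert (HD : is_RInt (fun t => poisson_kernel z t * g t - poisson_kernel z t * c)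
                 0 (2 * PI) (2 * PI * (poisson_integral g z - c))).
  { replace (2 * PI * (poisson_integral g z - c))
      with (RInt (fun t => poisson_kernel z t * g t) 0 (2 * PI) - 2 * PI * c)
      by (unfold poisson_integral; field; lra).
    apply (is_RInt_minus (V := R_NormedModule)).
    - apply (RInt_correct (V := R_CompleteNormedModule)), ex_RInt_poisson; assumption.
    - rewrite (Rmult_comm _ c). apply (is_RInt_ext (fun t => scal c (poisson_kernel z t))).
      + intros t _. apply Rmult_comm.
      + apply (is_RInt_scal (V := R_NormedModule)), HK. }
  assert (HE : Rabs (2 * PI * (poisson_integral g z - c)) <=
               eps * (2 * PI) + (2 * PI - 0) * B).
  { apply (norm_RInt_le (V := R_NormedModule)
      (fun t => poisson_kernel z t * g t - poisson_kernel z t * c)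
      (fun t => eps * poisson_kernel z t + B) 0 (2 * PI)); [lra| |exact HD|].
    - intros t Ht.
      change (Rabs (poisson_kernel z t * g t - poisson_kernel z t * c)
                <= eps * poisson_kernel z t + B).
      rewrite <- Rmult_minus_distr_l, Rabs_mult.
      rewrite (Rabs_pos_eq (poisson_kernel z t)) by (apply poisson_kernel_ge_0, Hz).
      apply H, Ht.
    - apply is_RInt_affine, HK. }
  rewrite Rabs_mult, (Rabs_pos_eq (2 * PI)) in HE by lra.
  apply (Rmult_le_reg_l (2 * PI)); [lra|]. lra.
Qed.

(* Near [z0] the kernel is uniformly small on the arc [|e^{it} - z0| >= delta], while on
   the rest of the circle [g] is close to its limit; both cases are absorbed in the
   pointwise bound [P |g - c| <= eps P + B]. *)
Lemma poisson_integral_boundary (g : R -> R) (z0 : C) (c : R) :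
  (forall t, continuous g t) -> Cmod z0 = 1 ->
  (forall eps, 0 < eps -> exists delta, 0 < delta /\
     forall t, Cmod (cis t - z0)%C < delta -> Rabs (g t - c) < eps) ->
  forall eps, 0 < eps -> exists delta, 0 < delta /\
    forall z, Cmod z < 1 -> Cmod (z - z0)%C < delta ->
      Rabs (poisson_integral g z - c) < eps.
Proof.
  intros Hg Hz0 Hc eps Heps. pose proof PI_RGT_0 as HPI.
  destruct (Hc (eps / 2)) as (d & Hd & Hcd); [lra|].
  destruct (continuity_ab_maj (fun t => Rabs (g t - c)) 0 (2 * PI)) as (m & HM & _).
  { lra. }
  { intros t _. apply continuity_pt_filterlim, (continuous_comp (fun t => g t - c) Rabs).
    - apply (continuous_minus (V := R_NormedModule)); [apply Hg|apply continuous_const].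
    - apply continuous_Rabs. }
  set (M := Rabs (g m - c)) in *. assert (HM0 : 0 <= M) by apply Rabs_pos.
  (* On the far arc P <= 2 |z - z0| / (d / 2)^2, and [M] bounds |g - c|; thus B = L |z - z0|, which
     the choice of radius keeps below eps / 2. *)
  set (L := 8 * M / (d * d)).
  assert (HL : 0 <= L) by (apply Rdiv_le_0_compat; nra).
  exists (Rmin (d / 2) (eps / 2 / (L + 1))). split.
  { apply Rmin_pos; [lra|]. apply Rdiv_lt_0_compat; lra. }
  intros z Hz1 Hz.
  assert (Hza : Cmod (z - z0)%C < d / 2) by (eapply Rlt_le_trans; [exact Hz|apply Rmin_l]).
  assert (Hzb : Cmod (z - z0)%C < eps / 2 / (L + 1))
    by (eapply Rlt_le_trans; [exact Hz|apply Rmin_r]).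
  apply Rle_lt_trans with (eps / 2 + L * Cmod (z - z0)%C).
  - apply poisson_integral_sub_const_le; [exact Hg|exact Hz1|]. intros t Ht2pi.
    pose proof (poisson_kernel_ge_0 z t Hz1) as HK.
    pose proof (Cmod_ge_0 (z - z0)%C) as H0.
    destruct (Rlt_dec (Cmod (cis t - z0)%C) d) as [Ht|Ht].
    + specialize (Hcd t Ht). nra.
    + assert (Hfar : d / 2 <= Cmod (cis t - z)%C).
      { pose proof (Cmod_triangle (cis t - z)%C (z - z0)%C) as T.
        replace (cis t - z + (z - z0))%C with (cis t - z0)%C in T by ring. lra. }
      (* Here 1 - |z|^2 = (|z0| - |z|)(1 + |z|), with |z0| = 1 and |z| < 1. *)
      assert (Hnum : 1 - Cmod z * Cmod z <= 2 * Cmod (z - z0)%C).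
      { pose proof (Cmod_le_sub_add z0 z) as T. rewrite Cmod_sub_comm in T.
        pose proof (Cmod_ge_0 z). nra. }
      assert (HKs : poisson_kernel z t <= 8 / (d * d) * Cmod (z - z0)%C).
      { rewrite poisson_kernel_Cmod.
        replace (8 / (d * d) * Cmod (z - z0)%C)
          with (2 * Cmod (z - z0)%C * / (d / 2 * (d / 2))) by (field; lra).
        apply Rmult_le_compat; [pose proof (Cmod_ge_0 z); nra| |exact Hnum|].
        - left. apply Rinv_0_lt_compat. nra.
        - apply Rinv_le_contravar; nra. }
      apply Rle_trans with (8 / (d * d) * Cmod (z - z0)%C * M).
      * apply Rmult_le_compat; [exact HK|apply Rabs_pos|exact HKs|apply HM, Ht2pi].
      * replace (8 / (d * d) * Cmod (z - z0)%C * M) with (L * Cmod (z - z0)%C)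
          by (unfold L; field; lra).
        nra.
  - apply Rlt_div_r in Hzb; [|lra]. pose proof (Cmod_ge_0 (z - z0)%C). nra.
Qed.

(** * The maximum principle *)

Lemma list_argmax {T : Type} (f : T -> R) (l : list T) :
  l <> nil -> exists t, In t l /\ forall s, In s l -> f s <= f t.
Proof.
  induction l as [|x l IH]; [congruence|]. intros _.
  destruct l as [|y l].
  - exists x. split; [left; reflexivity|]. intros s [<-|[]]. apply Rle_refl.
  - destruct IH as (t & Ht & Hmax); [discriminate|].
    destruct (Rle_dec (f x) (f t)) as [H|H].
    + exists t. split; [right; exact Ht|]. intros s [<-|Hs]; [exact H|apply Hmax, Hs].
    + exists x. split; [left; reflexivity|].
      intros s [<-|Hs]; [apply Rle_refl|]. specialize (Hmax s Hs). lra.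
Qed.

(** Without a maximum, every point has a neighbourhood on which [w] stays below its value at some
    point of the disc. Finitely many neighbourhoods cover the disc, and the best of the
    corresponding points would lie in one of them and be beaten. *)
Lemma closed_unit_disc_argmax (w : C -> R) :
  continuous_on closed_unit_disc w ->
  exists z, closed_unit_disc z /\ forall y, closed_unit_disc y -> w y <= w z.
Proof.
  intros Hw. apply NNPP. intros Hno.
  assert (Hstep : forall t : Compactness.Tn 2 R, exists p : posreal * C,
    closed_unit_disc (snd p) /\ forall y : C, closed_unit_disc y ->
      Rabs (fst y - fst t) < fst p -> Rabs (snd y - fst (snd t)) < fst p ->
      w y < w (snd p)).
  { intros (t1 & t2 & []). set (t := (t1, t2) : C).
    assert (Hball : exists delta, 0 < delta /\ exists z', closed_unit_disc z' /\
      forall y, closed_unit_disc y -> Cmod (y - t)%C < delta -> w y < w z').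
    { destruct (Rle_dec (Cmod t) 1) as [Ht|Ht].
      - destruct (not_all_ex_not _ _ (fun H => Hno (ex_intro _ t (conj Ht H)))) as [z' Hz'].
        apply imply_to_and in Hz'. destruct Hz' as [Hz' Hlt].
        destruct (proj1 (continuous_on_R_iff _ _) Hw t Ht (w z' - w t)) as (d & Hd & H); [lra|].
        exists d. split; [exact Hd|]. exists z'. split; [exact Hz'|].
        intros y Hy Hyt. specialize (H y Hy Hyt). apply Rabs_def2 in H. lra.
      (* Compactness is applied to the box [-1,1]^2, so centres outside the disc occur; their ball
         misses the disc and 0 is a dummy witness. *)
      - exists (Cmod t - 1). split; [lra|]. exists 0. split.
        + unfold closed_unit_disc. rewrite Cmod_0. lra.
        + intros y Hy Hyt. unfold closed_unit_disc in Hy.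
          pose proof (Cmod_le_sub_add t y) as H. rewrite Cmod_sub_comm in H. lra. }
    destruct Hball as (d & Hd & z' & Hz' & H).
    assert (Hd2 : 0 < d / 2) by lra.
    exists (mkposreal _ Hd2, z'). split; [exact Hz'|]. simpl. intros y Hy H1 H2.
    apply H; [exact Hy|].
    eapply Rle_lt_trans; [apply Cmod_2Rmax|].
    assert (Hm : Rmax (Rabs (fst (y - t)%C)) (Rabs (snd (y - t)%C)) < d / 2)
      by (apply Rmax_lub_lt; [exact H1|exact H2]).
    assert (Hs : sqrt 2 < 2) by (apply sqrt_less; lra).
    pose proof (sqrt_pos 2).
    pose proof (Rmax_l (Rabs (fst (y - t)%C)) (Rabs (snd (y - t)%C))).
    pose proof (Rabs_pos (fst (y - t)%C)). nra. }
  (* The covering lemma takes the radius as a function of the centre, hence the use of choice. *)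
  set (sel := fun t => proj1_sig (constructive_indefinite_description _ (Hstep t))).
  assert (Hsel : forall t, closed_unit_disc (snd (sel t)) /\
    forall y : C, closed_unit_disc y ->
      Rabs (fst y - fst t) < fst (sel t) -> Rabs (snd y - fst (snd t)) < fst (sel t) ->
      w y < w (snd (sel t))).
  { intros t. exact (proj2_sig (constructive_indefinite_description _ (Hstep t))). }
  (* The finite cover is given under a double negation, which suits the goal [False]. *)
  apply (compactness_list 2 (-1, (-1, tt)) (1, (1, tt)) (fun t => fst (sel t))).
  intros [l Hl].
  assert (Hcov : forall y : C, closed_unit_disc y ->
    exists t, In t l /\ w y < w (snd (sel t))).
  { intros y Hy. destruct (Hl (fst y, (snd y, tt))) as ([t1 [t2 []]] & Ht & _ & Hc).
    - pose proof (Rmax_Cmod y) as H. unfold closed_unit_disc in Hy.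
      pose proof (Rmax_l (Rabs (fst y)) (Rabs (snd y))).
      pose proof (Rmax_r (Rabs (fst y)) (Rabs (snd y))).
      simpl. split; [|split]; [apply Rabs_le_between; lra|apply Rabs_le_between; lra|exact I].
    - simpl in Hc. exists (t1, (t2, tt)). split; [exact Ht|].
      apply Hsel; [exact Hy|apply Hc|apply Hc]. }
  assert (H0 : closed_unit_disc 0) by (unfold closed_unit_disc; rewrite Cmod_0; lra).
  destruct (list_argmax (fun t => w (snd (sel t))) l) as (t & _ & Hmax).
  - intros E. destruct (Hcov 0 H0) as (t & Ht & _). rewrite E in Ht. exact Ht.
  - destruct (Hcov (snd (sel t)) (proj1 (Hsel t))) as (s & Hs & Hlt).
    specialize (Hmax s Hs). lra.
Qed.

(** Stated with [is_RInt], the averaging property includes integrability, so it passes to sums and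
    differences without side conditions. *)
Definition circle_mean_value (w : C -> R) : Prop :=
  forall (a : C) (r : R), 0 < r -> Cmod a + r < 1 ->
    is_RInt (fun theta => w (a + r * cis theta)%C) 0 (2 * PI) (2 * PI * w a).

(** Expanding the square leaves the cross term 2 r Re (conj a e^{i theta}), whose mean is 0. *)
Lemma is_RInt_Cmod_sqr_circle (a : C) (r : R) :
  is_RInt (fun theta => Cmod (a + r * cis theta)%C * Cmod (a + r * cis theta)%C)
    0 (2 * PI) (2 * PI * (Cmod a * Cmod a + r * r)).
Proof.
  apply (is_RInt_ext (fun theta =>
    2 * r * Re (Cconj a * cis (INR 1 * theta))%C + (Cmod a * Cmod a + r * r))).
  - intros theta _. rewrite !Cmod_sqr. simpl INR. rewrite Rmult_1_l.
    pose proof (sin2_cos2 theta) as T. unfold Rsqr in T.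
    unfold Re, cis, Cconj; simpl.
    replace (r * r) with (r * r * (sin theta * sin theta + cos theta * cos theta))
      by (rewrite T; ring).
    ring.
  - replace (2 * PI * (Cmod a * Cmod a + r * r))
      with (2 * r * 0 + (2 * PI - 0) * (Cmod a * Cmod a + r * r)) by ring.
    apply is_RInt_affine, RInt_cis_harmonic. auto with arith.
Qed.

Lemma maximum_principle (w : C -> R) :
  continuous_on closed_unit_disc w -> circle_mean_value w ->
  (forall z, unit_circle z -> w z <= 0) ->
  forall z, closed_unit_disc z -> w z <= 0.
Proof.
  intros Hw Hmean Hbd z Hz. apply le_epsilon. intros eps Heps.
  pose proof PI_RGT_0 as HPI.
  set (h := fun y => w y + eps * (Cmod y * Cmod y)).
  assert (Hh : continuous_on closed_unit_disc h).
  { apply continuous_on_R_iff. intros y Hy e He.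
    destruct (proj1 (continuous_on_R_iff _ _) Hw y Hy (e / 2)) as (d & Hd & H); [lra|].
    (* In the unit disc | |x|^2 - |y|^2 | <= 2 |x - y|, so the quadratic term changes by less than e
       / 2. *)
    exists (Rmin d (e / 2 / (2 * eps))). split.
    { apply Rmin_pos; [exact Hd|]. apply Rdiv_lt_0_compat; lra. }
    intros x Hx Hxy.
    assert (H1 : Cmod (x - y)%C < d) by (eapply Rlt_le_trans; [exact Hxy|apply Rmin_l]).
    assert (H2 : Cmod (x - y)%C < e / 2 / (2 * eps))
      by (eapply Rlt_le_trans; [exact Hxy|apply Rmin_r]).
    apply Rlt_div_r in H2; [|lra]. specialize (H x Hx H1).
    pose proof (Rabs_Cmod_sub_le x y) as H3.
    unfold closed_unit_disc in Hx, Hy.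
    pose proof (Cmod_ge_0 x). pose proof (Cmod_ge_0 y).
    unfold h.
    replace (w x + eps * (Cmod x * Cmod x) - (w y + eps * (Cmod y * Cmod y)))
      with ((w x - w y) + eps * ((Cmod x - Cmod y) * (Cmod x + Cmod y))) by ring.
    eapply Rle_lt_trans; [apply Rabs_triang|].
    rewrite !Rabs_mult, (Rabs_pos_eq eps), (Rabs_pos_eq (Cmod x + Cmod y)) by lra.
    assert (Hprod : Rabs (Cmod x - Cmod y) * (Cmod x + Cmod y) <= Cmod (x - y)%C * 2)
      by (apply Rmult_le_compat; [apply Rabs_pos|lra|lra|lra]).
    nra. }
  destruct (closed_unit_disc_argmax h Hh) as (m & Hm & Hmax).
  pose proof (Hmax z Hz) as Hzm. unfold h in Hzm.
  destruct (Req_dec (Cmod m) 1) as [E|E].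
  (* Maximum on the circle: w z <= h z <= h m = w m + eps <= eps. *)
  - specialize (Hbd m E). rewrite E in Hzm. nra.
  (* Interior maximum: the mean of [h] on this circle is h m + eps r^2, although [h] is at most
     [h m] there. *)
  - exfalso. unfold closed_unit_disc in Hm. set (r := (1 - Cmod m) / 2).
    assert (Hr : 0 < r) by (unfold r; lra).
    assert (Hmr : Cmod m + r < 1) by (unfold r; lra).
    assert (HI : is_RInt (fun theta => h (m + r * cis theta)%C) 0 (2 * PI)
      (2 * PI * w m + eps * (2 * PI * (Cmod m * Cmod m + r * r)))).
    { apply (is_RInt_plus (V := R_NormedModule)).
      - apply Hmean; assumption.
      - apply (is_RInt_scal (V := R_NormedModule)), is_RInt_Cmod_sqr_circle. }
    assert (HC : 2 * PI * w m + eps * (2 * PI * (Cmod m * Cmod m + r * r))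
                 <= (2 * PI - 0) * h m).
    { apply (is_RInt_le (fun theta => h (m + r * cis theta)%C) (fun _ => h m) 0 (2 * PI));
        [lra|exact HI|apply (is_RInt_const (V := R_NormedModule))|].
      intros theta _. apply Hmax. left. apply Cmod_circle_lt; assumption. }
    unfold h in HC. assert (Hgain : 0 < 2 * PI * (eps * (r * r))).
    { apply Rmult_lt_0_compat; [lra|]. apply Rmult_lt_0_compat; [exact Heps|nra]. }
    nra.
Qed.

(** * The Dirichlet problem *)

(* Unqualified, [disc] is the one of Stdlib's [Rtopology]. *)
Lemma disc_0_1 (z : C) : Defs.disc 0 1 z <-> Cmod z < 1.
Proof. unfold Defs.disc. replace (z - 0)%C with z by ring. reflexivity. Qed.

Lemma open_unit_disc : open (Defs.disc 0 1).
Proof.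
  intros z Hz. pose proof (proj1 (disc_0_1 z) Hz) as Hz1. apply (locally_Cmod z). exists (1 - Cmod z).
  split; [lra|]. intros y Hy. apply disc_0_1. pose proof (Cmod_le_sub_add y z). lra.
Qed.

Lemma Cmod_polar (a : C) : exists e : C, Cmod e = 1 /\ a = (Cmod a * e)%C.
Proof.
  destruct (classic (a = 0)) as [->|Ha].
  - exists 1. split; [apply Cmod_1|]. rewrite Cmod_0. ring.
  - pose proof (proj1 (Cmod_gt_0 a) Ha) as H.
    assert (H' : RtoC (Cmod a) <> 0) by (intros E; apply RtoC_inj in E; lra).
    exists (a / Cmod a)%C. split.
    + rewrite Cmod_div by exact H'. rewrite Cmod_R, Rabs_pos_eq by lra. field. lra.
    + field. exact H'.
Qed.

(** The point of the closure farthest from 0 is a + r e, where e is the direction of [a], and its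
    modulus is |a| + r. Conversely, a closure point of modulus at least 1 would be at distance at
    least 1 - (|a| + r) from every point of the disc. *)
Lemma closure_disc_subset_unit_disc (a : C) (r : R) :
  0 < r ->
  (forall z, Defs.closure (Defs.disc a r) z -> Defs.disc 0 1 z) <-> Cmod a + r < 1.
Proof.
  intros Hr. split.
  - intros H. destruct (Cmod_polar a) as (e & He & Ha).
    replace (Cmod a + r) with (Cmod (a + r * e)%C).
    + apply disc_0_1, H. intros P HP. apply (locally_Cmod (a + r * e)%C) in HP.
      destruct HP as (d & Hd & HP).
      (* The point a + s e is pulled back from the boundary by at most d / 2; the maximum with 0
         keeps it in the disc when [d] is large. *)
      set (s := Rmax 0 (r - d / 2)).
      assert (Hs : 0 <= s < r /\ r - s < d)
        by (unfold s, Rmax; destruct Rle_dec; lra).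
      exists (a + s * e)%C. split.
      * apply HP.
        replace (a + s * e - (a + r * e))%C with (RtoC (s - r) * e)%C
          by (rewrite RtoC_minus; ring).
        rewrite Cmod_mult, He, Cmod_R, Rabs_left; lra.
      * unfold Defs.disc. replace (a + s * e - a)%C with (RtoC s * e)%C by ring.
        rewrite Cmod_mult, He, Cmod_R, Rabs_pos_eq; lra.
    + replace (a + r * e)%C with (RtoC (Cmod a + r) * e)%C.
      * rewrite Cmod_mult, He, Cmod_R, Rabs_pos_eq; [ring|].
        pose proof (Cmod_ge_0 a). lra.
      * rewrite Ha at 2. rewrite RtoC_plus. ring.
  - intros H z Hz. apply disc_0_1. apply Rnot_le_lt. intros Hz1.
    destruct (Hz (fun y => Cmod (y - z)%C < 1 - (Cmod a + r))) as (y & Hy & Hya).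
    + apply (locally_Cmod z). exists (1 - (Cmod a + r)). split; [lra|]. auto.
    + unfold Defs.disc in Hya. pose proof (Cmod_le_sub_add z y) as H1.
      pose proof (Cmod_le_sub_add y a) as H2. rewrite Cmod_sub_comm in H1. lra.
Qed.

Lemma continuous_on_circle (D : C -> Prop) (w : C -> R) (a : C) (r : R) :
  continuous_on D w -> (forall theta, D (a + r * cis theta)%C) ->
  forall theta, continuous (fun theta => w (a + r * cis theta)%C) theta.
Proof.
  intros Hw HD theta P HP.
  destruct (proj1 (locally_Cmod _ _) (Hw _ (HD theta) P HP)) as (d & Hd & H).
  (* Continuity of [w] is only relative to [D]. Since the circle stays in [D], it suffices that the
     distance [n] to the reference point tends to 0. *)
  set (n := fun s => Cmod (a + r * cis s - (a + r * cis theta))%C).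
  assert (Hn : continuous n theta).
  { apply (continuous_ext (fun s => sqrt ((r * (cos s - cos theta)) ^ 2 +
                                          (r * (sin s - sin theta)) ^ 2))).
    - intros s. unfold n, Cmod, cis. simpl. f_equal. ring.
    - apply (continuous_comp (fun s => (r * (cos s - cos theta)) ^ 2 +
                                       (r * (sin s - sin theta)) ^ 2) sqrt).
      + apply (ex_derive_continuous (V := R_NormedModule)). auto_derive. exact I.
      + apply continuous_sqrt. }
  assert (H0 : n theta = 0).
  { unfold n. rewrite <- Cmod_0. f_equal. ring. }
  assert (L : locally theta (fun s => n s < d)).
  { apply (Hn (fun x => x < d)). exists (mkposreal _ Hd). intros x Hx.
    change (Rabs (x - n theta) < d) in Hx. rewrite H0, Rminus_0_r in Hx.
    apply Rabs_def2 in Hx. lra. }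
  apply (filter_imp _ _ (fun s Hs => H _ Hs (HD s)) L).
Qed.

Lemma RInt_circle_RtoC (w : C -> R) (a : C) (r l : R) :
  is_RInt (fun theta => w (a + r * cis theta)%C) 0 (2 * PI) l ->
  RInt (V := C_R_CompleteNormedModule)
    (fun theta : R => RtoC (w (a + r * cis theta)%C)) 0 (2 * PI) = RtoC l.
Proof. intros H. apply is_RInt_unique, is_RInt_RtoC, H. Qed.

(** The hypothesis only gives the value of the total function [RInt]; continuity on the circle
    supplies the integrability that turns it into [is_RInt]. *)
Lemma harmonic_ave_circle_mean_value (w : C -> R) :
  continuous_on closed_unit_disc w ->
  harmonic_ave (Defs.disc 0 1) (fun z => RtoC (w z)) -> circle_mean_value w.
Proof.
  intros Hw (_ & _ & H) a r Hr Ha. pose proof PI_RGT_0 as HPI.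
  specialize (H a r Hr (proj2 (closure_disc_subset_unit_disc a r Hr) Ha)).
  assert (HI : is_RInt (fun theta => w (a + r * cis theta)%C) 0 (2 * PI)
                 (RInt (fun theta => w (a + r * cis theta)%C) 0 (2 * PI))).
  { apply (RInt_correct (V := R_CompleteNormedModule)), ex_RInt_of_continuous.
    apply (continuous_on_circle closed_unit_disc); [exact Hw|].
    intros theta. left. apply Cmod_circle_lt; assumption. }
  rewrite (RInt_circle_RtoC w a r _ HI), <- RtoC_mult in H. apply RtoC_inj in H.
  replace (2 * PI * w a) with (RInt (fun theta => w (a + r * cis theta)%C) 0 (2 * PI));
    [exact HI|].
  assert (E : forall x y : R, x = 1 / (2 * PI) * y -> y = 2 * PI * x)
    by (intros x y ->; field; lra).
  apply E, H.
Qed.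

Lemma circle_mean_value_harmonic_ave (w : C -> R) :
  continuous_on (Defs.disc 0 1) w -> circle_mean_value w ->
  harmonic_ave (Defs.disc 0 1) (fun z => RtoC (w z)).
Proof.
  intros Hw H. pose proof PI_RGT_0 as HPI.
  split; [apply open_unit_disc|]. split; [apply continuous_on_RtoC, Hw|].
  intros a r Hr Ha. apply (closure_disc_subset_unit_disc a r Hr) in Ha.
  rewrite (RInt_circle_RtoC w a r _ (H a r Hr Ha)), <- RtoC_mult.
  f_equal. field. lra.
Qed.

Lemma dirichlet_solution_le (phi u v : C -> R) :
  dirichlet_solution phi u -> dirichlet_solution phi v ->
  forall z, closed_unit_disc z -> u z <= v z.
Proof.
  intros (Cu & Hu & Bu) (Cv & Hv & Bv) z Hz.
  apply Rminus_le. apply (maximum_principle (fun z => u z - v z)); [| | |exact Hz].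
  - intros y Hy.
    eapply (filterlim_comp_2 u (fun x => opp (v x)) plus).
    + apply Cu, Hy.
    + apply (filterlim_comp _ _ _ v opp _ (locally (v y))); [apply Cv, Hy|].
      apply (filterlim_opp (V := R_NormedModule)).
    + apply (filterlim_plus (V := R_NormedModule)).
  - intros a r Hr Ha. rewrite Rmult_minus_distr_l.
    apply (is_RInt_minus (V := R_NormedModule)).
    + apply (harmonic_ave_circle_mean_value u Cu Hu); assumption.
    + apply (harmonic_ave_circle_mean_value v Cv Hv); assumption.
  - intros y Hy. rewrite Bu, Bv by exact Hy. lra.
Qed.

(** On the circle the numerator of the kernel vanishes, so boundary values are imposed there; that
    they fit the integral is the content of [poisson_integral_boundary]. *)
Definition poisson_extension (phi : C -> R) (z : C) : R :=
  if Rlt_dec (Cmod z) 1 then poisson_integral (fun t => phi (cis t)) z else phi z.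

Lemma poisson_extension_interior (phi : C -> R) (z : C) :
  Cmod z < 1 -> poisson_extension phi z = poisson_integral (fun t => phi (cis t)) z.
Proof. intros H. unfold poisson_extension. destruct Rlt_dec; [reflexivity|lra]. Qed.

Lemma poisson_extension_circle (phi : C -> R) (z : C) :
  unit_circle z -> poisson_extension phi z = phi z.
Proof.
  unfold unit_circle. intros H. unfold poisson_extension. destruct Rlt_dec; [lra|reflexivity].
Qed.

Lemma continuous_cis_comp (phi : C -> R) :
  continuous_on unit_circle phi -> forall t, continuous (fun t => phi (cis t)) t.
Proof.
  intros H t.
  apply (continuous_ext (fun t => phi (0 + 1 * cis t)%C)).
  - intros s. f_equal. ring.
  - apply (continuous_on_circle unit_circle phi 0 1 H). intros s.
    unfold unit_circle. replace (0 + 1 * cis s)%C with (cis s) by ring. apply Cmod_cis.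
Qed.

Lemma continuous_on_poisson_extension (phi : C -> R) :
  continuous_on unit_circle phi -> continuous_on closed_unit_disc (poisson_extension phi).
Proof.
  intros Hphi. pose proof (continuous_cis_comp phi Hphi) as Hg.
  apply continuous_on_R_iff. intros z Hz eps Heps.
  destruct (Rlt_dec (Cmod z) 1) as [H1|H1].
  - destruct (poisson_integral_continuous _ z Hg H1 eps Heps) as (d & Hd & H).
    (* The bound 1 - |z| keeps [y] in the open disc, where the extension is the integral. *)
    exists (Rmin d (1 - Cmod z)). split; [apply Rmin_pos; lra|].
    intros y _ Hy.
    pose proof (Rmin_l d (1 - Cmod z)). pose proof (Rmin_r d (1 - Cmod z)).
    pose proof (Cmod_le_sub_add y z).
    rewrite !poisson_extension_interior by lra. apply H. lra.
  - assert (Hz1 : unit_circle z) by (unfold closed_unit_disc, unit_circle in *; lra).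
    rewrite (poisson_extension_circle phi z Hz1).
    pose proof (proj1 (continuous_on_R_iff _ _) Hphi z Hz1) as Hc.
    destruct (poisson_integral_boundary (fun t => phi (cis t)) z (phi z) Hg Hz1) with (eps := eps)
      as (d1 & Hd1 & HI); [|exact Heps|].
    + intros e He. destruct (Hc e He) as (d & Hd & H). exists d. split; [exact Hd|].
      intros t. apply H, Cmod_cis.
    + destruct (Hc eps Heps) as (d2 & Hd2 & HB).
      exists (Rmin d1 d2). split; [apply Rmin_pos; assumption|].
      intros y Hy Hyz. pose proof (Rmin_l d1 d2). pose proof (Rmin_r d1 d2).
      destruct (Rlt_dec (Cmod y) 1) as [Hy1|Hy1].
      * rewrite poisson_extension_interior by exact Hy1. apply HI; lra.
      * assert (Hyc : unit_circle y) by (unfold closed_unit_disc, unit_circle in *; lra).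
        rewrite poisson_extension_circle by exact Hyc. apply HB; [exact Hyc|lra].
Qed.

Lemma dirichlet_solution_poisson_extension (phi : C -> R) :
  continuous_on unit_circle phi -> dirichlet_solution phi (poisson_extension phi).
Proof.
  intros Hphi. pose proof (continuous_on_poisson_extension phi Hphi) as Hu.
  split; [exact Hu|]. split; [|apply poisson_extension_circle].
  apply circle_mean_value_harmonic_ave.
  - apply (continuous_on_subset closed_unit_disc); [|exact Hu].
    intros z Hz. left. apply disc_0_1, Hz.
  - intros a r Hr Ha. rewrite poisson_extension_interior by lra.
    apply (is_RInt_ext (fun theta =>
      poisson_integral (fun t => phi (cis t)) (a + r * cis theta)%C)).
    + intros theta _. rewrite poisson_extension_interior; [reflexivity|].
      apply Cmod_circle_lt; assumption.
    + apply is_RInt_poisson_integral_circle; [|exact Hr|exact Ha].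
      apply continuous_cis_comp, Hphi.
Qed.

Theorem mainTheorem1 (phi : C -> R) (hphi : continuous_on unit_circle phi) :
  exists u : C -> R,
    dirichlet_solution phi u /\
    forall v : C -> R, dirichlet_solution phi v ->
      forall z : C, closed_unit_disc z -> v z = u z.
Proof.
  pose proof (dirichlet_solution_poisson_extension phi hphi) as Hu.
  exists (poisson_extension phi). split; [exact Hu|]. intros v Hv z Hz.
  apply Rle_antisym; eapply dirichlet_solution_le; eassumption.
Qed.
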